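(* Let $\{T_k\}$ be a family of NT-statistics built from functions $l_1,l_2,\ldots$ and $S$ a selection rule for the family, with penalty $\pi$ and control sequence $d(n)$. Assume that $Y_1,\ldots,Y_n$ are i.i.d. Let $E\,l(Y_1)=0$ and assume that for every $k$ the vector $(l_1(Y_i),\ldots,l_k(Y_i))$ has the unit (identity) covariance matrix. Suppose that $\|(l_1(Y_1),\ldots,l_k(Y_1))\|_k\le M(k)$ almost everywhere for every $k$, where $\|\cdot\|_k$ is the norm of the $k$-dimensional Euclidean space. Assume $\pi(k,n)-\pi(1,n)\ge 2k$ for all $k\ge2$ and $$\lim_{n\to\infty}\frac{M(d(n))\,\pi(d(n),n)}{\sqrt n}=0 .$$ Then $S=O_{P_0}(1)$ and $T_S=O_{P_0}(1)$ (i.e. $S$ and $T_S$ are bounded in probability under $P_0$ as $n\to\infty$).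
   Context: Setting. $Y_1,Y_2,\ldots$ take values in a measurable space $\mathbb{Y}$, and $l_1,l_2,\ldots:\mathbb{Y}\to\mathbb{R}$ are known measurable functions. $P_0$ is the distribution of the $Y_i$'s under the null hypothesis (and also denotes the corresponding probability), with expectation $E_0$; the expectation $E$, the covariance matrices and ''almost everywhere'' in the claim are taken under $P_0$. NT-statistics. For each $k$ put $l=(l_1,\ldots,l_k)$ (a row vector), with $E_0\,l(Y)=0$, and let $L_k=\{E_0[l(Y)]^T l(Y)\}^{-1}$, assumed well defined with finite entries. The NT-statistic based on $Y_1,\ldots,Y_n$ is $$T_k=\Bigl\{\tfrac{1}{\sqrt n}\sum_{j=1}^n l(Y_j)\Bigr\}\,L_k\,\Bigl\{\tfrac{1}{\sqrt n}\sum_{j=1}^n l(Y_j)\Bigr\}^T .$$ Selection rule. $d(n)$ is a sequence of positive integers with $d(n)\to\infty$ as $n\to\infty$. A penalty is a function $\pi:\mathbb{N}\times\mathbb{N}\to\mathbb{R}$ with $\pi(1,n)<\pi(2,n)<\cdots<\pi(d(n),n)$ for all $n$ and $\pi(j,n)-\pi(1,n)\to\infty$ as $n\to\infty$ for every $j=2,\ldots,d(n)$. The selection rule $S$ is $$S=\min\{k:\ 1\le k\le d(n);\ T_k-\pi(k,n)\ge T_j-\pi(j,n),\ j=1,\ldots,d(n)\},$$ and $T_S$ is the data-driven NT-statistic.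
   Formalization: The penalty is additionally assumed nonnegative, π(1,n) ≥ 0 for all n; with penalties of arbitrary sign the claim fails, since S depends only on differences of π while the limit condition depends on its absolute level. *)

(* Defs.v *)
From HB Require Import structures.
From mathcomp Require Import all_boot all_order all_algebra.
From mathcomp Require Import all_classical all_reals all_analysis.

Set Implicit Arguments.
Unset Strict Implicit.
Unset Printing Implicit Defensive.

Import Order.TTheory GRing.Theory Num.Theory.
Import numFieldNormedType.Exports.

Local Open Scope classical_set_scope.
Local Open Scope ring_scope.

(* The observations Y_1, Y_2, ... and the functions l_1, l_2, ... are indexed
   from 0 ([Y j] is Y_{j+1}, [l i] is l_{i+1}); model dimensions k and sample
   sizes n keep their usual values, starting at 1. *)

Section Sample.
Context {dO dY : measure_display} {Omega : measurableType dO}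
  {YY : measurableType dY} {R : realType}.
Variable P0 : probability Omega R.

Definition mutually_independent (Y : nat -> {RV P0 >-> YY}) : Prop :=
  forall (J : seq nat) (A : nat -> set YY),
    uniq J -> (forall j, measurable (A j)) ->
    P0 (\bigcap_(j in [set` J]) (Y j @^-1` A j)) =
    (\prod_(j <- J) P0 (Y j @^-1` A j))%E.

Definition identically_distributed (Y : nat -> {RV P0 >-> YY}) : Prop :=
  forall (i j : nat) (A : set YY), measurable A ->
    distribution P0 (Y i) A = distribution P0 (Y j) A.

Definition iid (Y : nat -> {RV P0 >-> YY}) : Prop :=
  mutually_independent Y /\ identically_distributed Y.

Definition bounded_in_probability (X : nat -> Omega -> R) : Prop :=
  forall eps : R, 0 < eps ->
    exists C : R, \forall n \near \oo,
      (P0 [set w | (C < `|X n w|)%R] <= eps%:E)%E.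

End Sample.

(* The norm [`|_|] of the library on 'rV[R]_k is the sup norm. *)
Definition euclidean_norm (R : realType) (k : nat) (v : 'rV[R]_k) : R :=
  Num.sqrt (\sum_(i < k) v ord0 i ^+ 2).

Section NTStatistic.
Context {dO dY : measure_display} {Omega : measurableType dO}
  {YY : measurableType dY} {R : realType}.
Variables (P0 : probability Omega R) (Y : nat -> {RV P0 >-> YY})
  (l : nat -> {mfun YY >-> R}).

Definition lvec (k : nat) (y : YY) : 'rV[R]_k := \row_(i < k) l i y.

(* E_0[l(Y)^T l(Y)], with the first observation as the generic copy of Y. *)
Definition second_moment (k : nat) : 'M[R]_k :=
  \matrix_(i < k, j < k)
    fine ('E_P0[fun w => ((lvec k (Y 0%N w))^T *m lvec k (Y 0%N w)) i j])%E.

Definition NT_L (k : nat) : 'M[R]_k := invmx (second_moment k).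

Definition normalized_sum (k n : nat) (w : Omega) : 'rV[R]_k :=
  (Num.sqrt n%:R)^-1 *: \sum_(j < n) lvec k (Y j w).

Definition NT (k n : nat) (w : Omega) : R :=
  (normalized_sum k n w *m NT_L k *m (normalized_sum k n w)^T) ord0 ord0.

End NTStatistic.

Definition is_penalty (R : realType) (d : nat -> nat) (pen : nat -> nat -> R)
    : Prop :=
  (forall n j : nat, (0 < n)%N -> (0 < j < d n)%N -> pen j n < pen j.+1 n) /\
  (forall j : nat, (2 <= j)%N -> pen j n - pen 1%N n @[n --> \oo] --> +oo).

Section Selection.
Context {R : realType} {Omega : Type}.
Variables (d : nat -> nat) (pen : nat -> nat -> R)
  (T : nat -> nat -> Omega -> R).

Definition optimal_dim (n : nat) (w : Omega) (k : nat) : bool :=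
  all (fun j => T j n w - pen j n <= T k n w - pen k n) (iota 1 (d n)).

(* The least optimal k in 1, ..., d n, as [iota] is increasing. *)
Definition selection (n : nat) (w : Omega) : nat :=
  head 0%N [seq k <- iota 1 (d n) | optimal_dim n w k].

Lemma selection_spec (n : nat) (w : Omega) : (0 < d n)%N ->
  [/\ (1 <= selection n w <= d n)%N,
      forall j, (1 <= j <= d n)%N ->
        T j n w - pen j n <=
        T (selection n w) n w - pen (selection n w) n &
      forall k, (1 <= k <= d n)%N ->
        (forall j, (1 <= j <= d n)%N ->
           T j n w - pen j n <= T k n w - pen k n) ->
        (selection n w <= k)%N].
Proof.
move=> dn0; pose f (k : nat) := T k n w - pen k n.
have memE k : (k \in iota 1 (d n)) = (1 <= k <= d n)%N.
  by rewrite mem_iota add1n ltnS.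
have optP k : reflect (forall j, (1 <= j <= d n)%N -> f j <= f k)
    (optimal_dim n w k).
  apply: (iffP allP) => h j; first by rewrite -memE; exact: h.
  by rewrite memE; exact: h.
set s := [seq k <- iota 1 (d n) | optimal_dim n w k].
have sE k : (k \in s) = optimal_dim n w k && (1 <= k <= d n)%N.
  by rewrite mem_filter memE.
have s_sorted : sorted leq s.
  by apply: sorted_filter; [exact: leq_trans | exact: iota_sorted].
have [k0 k0s] : exists k, k \in s.
  have [i _ hi] := arg_maxP (fun i : 'I_(d n) => f i.+1)
    (isT : xpredT (Ordinal dn0)).
  exists i.+1; rewrite sE /= ltn_ord andbT; apply/optP => -[|j] //= jd.
  exact: (hi (Ordinal jd)).
rewrite /selection -/s; case: s sE s_sorted k0s => // a s sE sa _ /=.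
have /andP[/optP ao ad] : optimal_dim n w a && (1 <= a <= d n)%N.
  by rewrite -sE mem_head.
split=> // k kd kopt.
have : k \in a :: s by rewrite sE kd andbT; apply/optP.
rewrite inE => /predU1P[->//|ks].
by move: sa; rewrite /= (path_sortedE leq_trans) => /andP[/allP/(_ _ ks)].
Qed.

End Selection.

(* Main.v *)
Require Import Defs.
From mathcomp Require Import all_boot all_order all_algebra.
From mathcomp Require Import all_classical all_reals all_analysis.
From mathcomp Require Import measurable_realfun ring lra zify.

(** Write [X_j = (l_1(Y_j), ..., l_k(Y_j))]. As the covariance is the identity,
    [T_k] is the squared length of [n^(-1/2) (X_1 + ... + X_n)], so [T_k] is
    nondecreasing in [k] and has mean [k].

    The whole proof rests on one second-moment bound,
      [E (T_k - k)^2 <= 4 k + 2 k B / n] when [|X_j|^2 <= B] almost everywhere,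
    proved by induction on [n] ([mean_excess_sq]). Adding one observation to the
    random walk changes its squared length by twice the scalar product of
    the walk with the new step, plus the squared length of the step. The
    first term and the centred second term are uncorrelated with the past.
    With [B = M(d(n))^2], the limit assumption on [M] and [pen] makes
    [B / n <= 1] eventually, so the variance of [T_k] is at most [6 k] for all
    [k <= d(n)] at once.

    If [S = k >= 2], comparing with dimension 1 gives
    [T_k >= pen(k,n) - pen(1,n) >= 2 k], twice the mean of [T_k]. Chebyshev
    bounds the probability of this by a multiple of [1/k], which cannot be
    summed over [k]. Monotonicity of [T_k] repairs this: the values [k] with
    [x^2 <= k < (x+1)^2] all force [T_(x^2+2x) >= 2 x^2], an event of
    probability at most [36 / x^2], and these bounds are summable. Hence
    [P(S >= m^2) <= 36 / (m - 1)] for [m >= 4] ([selection_tail]), uniformly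
    for large [n].

    Finally, off the event [S >= K] monotonicity gives [T_S <= T_K], and [T_K]
    has mean [K], so Markov's inequality bounds [T_S]
    ([selected_statistic_tail]).

    Independence is given for events. It is passed on to products of
    essentially bounded functions of distinct observations
    ([mean_prod_independent]), and from there to polynomials in the [l_i(Y_j)]
    by linearity ([mean_past_observable]). *)

Set Implicit Arguments.
Unset Strict Implicit.
Unset Printing Implicit Defensive.

Import Order.TTheory GRing.Theory Num.Theory.
Import numFieldNormedType.Exports.

Local Open Scope classical_set_scope.
Local Open Scope ring_scope.

(** * Means of essentially bounded random variables *)

Section EssBounded.
Context {dO : measure_display} {Omega : measurableType dO} {R : realType}.
Variable P : probability Omega R.
Implicit Types X Z : Omega -> R.

(** The class is closed under sums and products and consists of integrable
    functions, so moments of any order can be handled without further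
    integrability conditions. *)
Definition ess_bounded X : Prop :=
  measurable_fun setT X /\
  exists c : R, {ae P, forall w, `|X w| <= c}.

Definition mean X : R := \int[P]_w X w.

Lemma ess_bounded_integrable X : ess_bounded X -> P.-integrable setT (EFin \o X).
Proof.
move=> [mX [c cX]]; apply/integrableP; split; first exact/measurable_EFinP.
apply: le_lt_trans (_ : (\int[P]_(w in setT) (cst (Num.max c 0)%:E w) < +oo)%E).
  apply: ae_ge0_le_integral => //.
  - by apply: measurableT_comp => //; exact/measurable_EFinP.
  - by move=> w _ /=; rewrite lee_fin le_max lexx orbT.
  - apply: filterS cX => w h _ /=.
    by rewrite lee_fin le_max h.
by rewrite integral_cst//= probability_setT mule1 ltry.
Qed.

Lemma ess_bounded_cst c : ess_bounded (fun=> c).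
Proof. by split=> //; exists `|c|; apply: aeW. Qed.

Lemma ess_boundedD X Z : ess_bounded X -> ess_bounded Z ->
  ess_bounded (fun w => X w + Z w).
Proof.
move=> [mX [a hX]] [mZ [b hZ]]; split; first exact: measurable_funD.
exists (a + b); apply: filterS2 hX hZ => w h1 h2.
by rewrite (le_trans (ler_normD _ _))// lerD.
Qed.

Lemma ess_boundedM X Z : ess_bounded X -> ess_bounded Z ->
  ess_bounded (fun w => X w * Z w).
Proof.
move=> [mX [a hX]] [mZ [b hZ]]; split; first exact: measurable_funM.
exists (a * b); apply: filterS2 hX hZ => w h1 h2.
by rewrite normrM ler_pM.
Qed.

Lemma ess_boundedZ c X : ess_bounded X -> ess_bounded (fun w => c * X w).
Proof. by move=> bX; apply: ess_boundedM => //; exact: ess_bounded_cst. Qed.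

Lemma ess_boundedB X Z : ess_bounded X -> ess_bounded Z ->
  ess_bounded (fun w => X w - Z w).
Proof.
move=> bX /(ess_boundedZ (-1)) bZ.
rewrite (_ : (fun w => _) = fun w => X w + -1 * Z w); first exact: ess_boundedD.
by apply/funext => w; rewrite mulN1r.
Qed.

Lemma ess_bounded_sum (I : Type) (r : seq I) (F : I -> Omega -> R) :
  (forall i, ess_bounded (F i)) -> ess_bounded (fun w => \sum_(i <- r) F i w).
Proof.
move=> bF; elim: r => [|i r IH].
  by under eq_fun do rewrite big_nil; exact: ess_bounded_cst.
by under eq_fun do rewrite big_cons; exact: ess_boundedD.
Qed.

Lemma ess_bounded_prod (I : Type) (r : seq I) (Q : pred I) (F : I -> Omega -> R) :
  (forall i, ess_bounded (F i)) -> ess_bounded (fun w => \prod_(i <- r | Q i) F i w).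
Proof.
move=> bF; elim: r => [|i r IH].
  by under eq_fun do rewrite big_nil; exact: ess_bounded_cst.
under eq_fun do rewrite big_cons.
by case: (Q i) => //; exact: ess_boundedM.
Qed.

Lemma ess_bounded_indic (A : set Omega) : measurable A -> ess_bounded \1_A.
Proof.
move=> mA; split; first exact: measurable_indic.
by exists 1; apply: aeW => w; rewrite /indic ger0_norm// lern1 leq_b1.
Qed.

Lemma mean_fine X : fine ('E_P[X])%E = mean X.
Proof. by rewrite unlock. Qed.

Lemma eq_mean X Z : X =1 Z -> mean X = mean Z.
Proof. by move=> XZ; apply: eq_Rintegral => w _. Qed.

Lemma mean_cst c : mean (fun=> c) = c.
Proof. by rewrite /mean Rintegral_cst// (congr1 fine (probability_setT P)) mulr1. Qed.

Lemma meanD X Z : ess_bounded X -> ess_bounded Z ->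
  mean (fun w => X w + Z w) = mean X + mean Z.
Proof. by move=> bX bZ; apply: RintegralD => //; exact: ess_bounded_integrable. Qed.

Lemma meanB X Z : ess_bounded X -> ess_bounded Z ->
  mean (fun w => X w - Z w) = mean X - mean Z.
Proof. by move=> bX bZ; apply: RintegralB => //; exact: ess_bounded_integrable. Qed.

Lemma meanZ c X : ess_bounded X -> mean (fun w => c * X w) = c * mean X.
Proof. by move=> bX; apply: RintegralZl => //; exact: ess_bounded_integrable. Qed.

Lemma mean_sum (I : Type) (r : seq I) (F : I -> Omega -> R) :
  (forall i, ess_bounded (F i)) ->
  mean (fun w => \sum_(i <- r) F i w) = \sum_(i <- r) mean (F i).
Proof.
move=> bF; elim: r => [|i r IH].
  by rewrite big_nil -[RHS](mean_cst 0); apply: eq_mean => w; rewrite big_nil.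
rewrite big_cons -IH -meanD//; last exact: ess_bounded_sum.
by apply: eq_mean => w; rewrite big_cons.
Qed.

Lemma mean_indic (A : set Omega) : measurable A -> mean \1_A = fine (P A).
Proof. by move=> mA; rewrite /mean /Rintegral integral_indic// setIT. Qed.

Lemma mean_le X Z : ess_bounded X -> ess_bounded Z ->
  {ae P, forall w, X w <= Z w} -> mean X <= mean Z.
Proof.
move=> bX bZ XZ; rewrite -subr_ge0 -meanB//.
have [mU _] := ess_boundedB bZ bX.
have mU' : measurable_fun setT (fun w => Num.max (Z w - X w) 0).
  exact: measurable_maxr.
rewrite /mean /Rintegral
  (ae_eq_integral (fun w => (Num.max (Z w - X w) 0)%:E))//.
- by apply: Rintegral_ge0 => w _; rewrite le_max lexx orbT.
- exact/measurable_EFinP.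
- exact/measurable_EFinP.
- apply: filterS XZ => w h _; congr EFin.
  by apply/esym/max_idPl; rewrite subr_ge0.
Qed.

Lemma mean_norm_le X Z : ess_bounded X -> ess_bounded Z ->
  {ae P, forall w, `|X w| <= Z w} -> `|mean X| <= mean Z.
Proof.
move=> bX bZ XZ; rewrite ler_norml; apply/andP; split.
  rewrite -mulN1r -meanZ//; apply: mean_le => //; first exact: ess_boundedZ.
  by apply: filterS XZ => w; rewrite mulN1r ler_norml => /andP[].
by apply: mean_le => //; apply: filterS XZ => w; rewrite ler_norml => /andP[].
Qed.

Lemma markov_mean (A : set Omega) (c : R) X : measurable A -> 0 < c ->
  ess_bounded X -> (forall w, 0 <= X w) -> (forall w, A w -> c <= X w) ->
  (P A <= (mean X / c)%:E)%E.
Proof.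
move=> mA c0 bX X0 AX.
rewrite -(fineK (fin_num_measure P _ mA)) lee_fin -mean_indic//.
rewrite ler_pdivlMr// mulrC -meanZ; last exact: ess_bounded_indic.
apply: mean_le => //; first by apply: ess_boundedZ; exact: ess_bounded_indic.
apply: aeW => w; rewrite /indic.
by have [/set_mem/AX|] := boolP (w \in A); rewrite ?mulr1 ?mulr0.
Qed.

End EssBounded.

(** * Independence of observations *)

Section Independence.
Context {dO dY : measure_display} {Omega : measurableType dO}
  {YY : measurableType dY} {R : realType}.
Variables (P : probability Omega R).
Notation E := (mean P).

Lemma ess_bounded_indic_comp (U : {RV P >-> YY}) (A : set YY) : measurable A ->
  ess_bounded P (\1_A \o U).
Proof.
move=> mA; rewrite -[_ \o _]/(\1_(U @^-1` A)).
by apply: ess_bounded_indic; rewrite -[X in measurable X]setTI; exact: measurable_funPT.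
Qed.

(** Let [0 <= f(U) <= c]. Subtracting [c/2] on the event [f(U) >= c/2] does
    not change [E (G f(U))], by orthogonality of [G] to indicators, and leaves
    a function with values in [[0, c/2]]. After [n] such halvings
    [|E (G f(U))| <= c 2^-n E |G|], so the mean vanishes. *)
Lemma orthogonal_to_indicators (U : {RV P >-> YY}) (G : Omega -> R) (f : YY -> R) :
    ess_bounded P G ->
    (forall A, measurable A -> E (fun w => G w * \1_A (U w)) = 0) ->
    measurable_fun setT f -> ess_bounded P (f \o U) ->
  E (fun w => G w * f (U w)) = 0.
Proof.
move=> bG G0.
have bnG : ess_bounded P (fun w => `|G w|).
  case: bG => mG [c cG]; split; first exact: measurableT_comp.
  by exists c; apply: filterS cG => w; rewrite normr_id.
have halving n : forall (c : R) (g : YY -> R), measurable_fun setT g ->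
    {ae P, forall w, 0 <= g (U w) <= c} ->
    `|E (fun w => G w * g (U w))| <= c / 2 ^+ n * E (fun w => `|G w|).
  have bg (c : R) (g : YY -> R) : measurable_fun setT g ->
      {ae P, forall w, 0 <= g (U w) <= c} -> ess_bounded P (g \o U).
    move=> mg gc; split; first exact: measurableT_comp.
    by exists c; apply: filterS gc => w /andP[g0 ?] /=; rewrite ger0_norm.
  elim: n => [|n IH] c g mg gc.
    rewrite expr0 divr1 -meanZ//; apply: mean_norm_le.
    - by apply: ess_boundedM => //; exact: bg gc.
    - exact: ess_boundedZ.
    - apply: filterS gc => w /andP[g0 gc].
      by rewrite normrM mulrC ler_wpM2r// ger0_norm.
  pose A := [set y | c / 2 <= g y].
  have mA : measurable A.
    rewrite /A -[X in measurable X]setTI.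
    apply: (@measurable_fun_le _ _ _ setT (cst (c / 2)) g) => //.
  pose g' y := g y - c / 2 * \1_A y.
  have mg' : measurable_fun setT g'.
    by apply: measurable_funB => //; apply: measurable_funM => //; exact: measurable_indic.
  have g'c : {ae P, forall w, 0 <= g' (U w) <= c / 2}.
    apply: filterS gc => w /andP[g0 gc]; rewrite /g' /indic.
    have [/set_mem|] := boolP (U w \in A); rewrite /A /=.
      by move=> h; apply/andP; split; lra.
    by rewrite notin_setE /= => /negP; rewrite -ltNge => h; apply/andP; split; lra.
  have -> : E (fun w => G w * g (U w)) = E (fun w => G w * g' (U w)).
    have -> : E (fun w => G w * g (U w)) =
        E (fun w => G w * g' (U w) + c / 2 * (G w * \1_A (U w))).
      by apply: eq_mean => w; rewrite /g'; ring.
    have bA : ess_bounded P (fun w => G w * \1_A (U w)).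
      by apply: ess_boundedM => //; exact: ess_bounded_indic_comp.
    rewrite meanD ?meanZ ?G0 ?mulr0 ?addr0//; last exact: ess_boundedZ.
    by apply: ess_boundedM => //; exact: bg g'c.
  apply: le_trans (IH _ _ mg' g'c) _.
  by rewrite exprS invfM mulrA.
move=> mf [mfU [c fc]].
have EG0 : E G = 0.
  rewrite -(G0 setT)//; apply: eq_mean => w.
  by rewrite /indic in_setT mulr1.
(* Shifting by the constant makes the function nonnegative, at no cost as the
   mean of [G] is zero. *)
pose g y := f y + c.
have -> : E (fun w => G w * f (U w)) = E (fun w => G w * g (U w)).
  have -> : E (fun w => G w * g (U w)) = E (fun w => G w * f (U w) + c * G w).
    by apply: eq_mean => w; rewrite /g; ring.
  rewrite meanD ?meanZ// ?EG0 ?mulr0 ?addr0//; last exact: ess_boundedZ.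
  by apply: ess_boundedM => //; split=> //; exists c.
have mg : measurable_fun setT g by exact: measurable_funD.
have gc : {ae P, forall w, 0 <= g (U w) <= c + c}.
  apply: filterS fc => w; rewrite /g /= ler_norml => /andP[h1 h2].
  by apply/andP; split; lra.
set x := E _; set K := (c + c) * E (fun w => `|G w|).
have xK n : `|x| * 2 ^+ n <= K.
  have := halving n _ _ mg gc; rewrite -/x => h.
  rewrite -ler_pdivlMr ?exprn_gt0//; apply: le_trans h _.
  by rewrite /K mulrAC.
apply/eqP; rewrite -normr_eq0 eq_le normr_ge0 andbT leNgt; apply/negP => x0.
have := xK (Num.bound (K / `|x|)); apply/negP; rewrite -ltNge.
rewrite mulrC -ltr_pdivrMr//; exact: upper_nthrootP.
Qed.

Variable Y : nat -> {RV P >-> YY}.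

Definition observable (j : nat) (f : YY -> R) : Prop :=
  measurable_fun setT f /\ ess_bounded P (f \o Y j).

Lemma observable_indic j (A : set YY) : measurable A -> observable j \1_A.
Proof.
by move=> mA; split; [exact: measurable_indic | exact: ess_bounded_indic_comp].
Qed.

Lemma mean_prod_indicators (J : seq nat) (A : nat -> set YY) :
    mutually_independent Y -> uniq J -> (forall j, measurable (A j)) ->
  E (fun w => \prod_(j <- J) \1_(A j) (Y j w)) =
  \prod_(j <- J) E (\1_(A j) \o Y j).
Proof.
move=> indep uJ mA.
have mY j : measurable (Y j @^-1` A j).
  by rewrite -[X in measurable X]setTI; exact: measurable_funPT.
have EP (s : seq nat) : (\prod_(j <- s) P (Y j @^-1` A j))%E =
    (\prod_(j <- s) fine (P (Y j @^-1` A j)))%:E.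
  elim: s => [|j s IH]; first by rewrite !big_nil.
  by rewrite !big_cons IH EFinM fineK// fin_num_measure.
transitivity (E \1_(\bigcap_(j in [set` J]) (Y j @^-1` A j))).
  apply: eq_mean => w; rewrite /indic.
  have [/set_mem h|] := boolP (w \in _).
    rewrite big_seq big1// => j jJ.
    by rewrite mem_set//; exact: h.
  rewrite notin_setE => h.
  have [j jJ jA] : exists2 j, j \in J & ~ A j (Y j w).
    apply: contrapT => h'; apply: h => j /= jJ.
    by apply: contrapT => h''; apply: h'; exists j.
  rewrite (big_rem j)//= memNset ?mul0r//.
rewrite mean_indic; last by apply: bigcap_measurableType => j _; exact: mY.
rewrite indep// EP /=.
apply: eq_bigr => j _; rewrite -[_ \o _]/(\1_(Y j @^-1` A j)).
by rewrite mean_indic.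
Qed.

(** The indicators of an independent family are traded for general
    functions one index at a time: with the other factors fixed and their
    product centred, [orthogonal_to_indicators] passes from indicators to an
    arbitrary bounded function of [Y m]. *)
Lemma mean_prod_independent (J : seq nat) (f : nat -> YY -> R) :
    mutually_independent Y -> uniq J -> (forall j, observable j (f j)) ->
  E (fun w => \prod_(j <- J) f j (Y j w)) = \prod_(j <- J) E (f j \o Y j).
Proof.
move=> indep uJ.
(* Induction on [m], where only the factors of index below [m] may differ from
   an indicator. *)
suff main m : forall f, (forall j, observable j (f j)) ->
    (forall j, (m <= j)%N -> exists2 A, measurable A & f j = \1_A) ->
    E (fun w => \prod_(j <- J) f j (Y j w)) = \prod_(j <- J) E (f j \o Y j).
  move=> of_; pose m := (\max_(j <- J) j).+1.
  pose g j := if (j < m)%N then f j else \1_setT.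
  have fg j : j \in J -> g j = f j.
    by move=> jJ; rewrite /g ltnS (leq_bigmax_seq (F := id)).
  have := main m g; rewrite big_seq.
  under eq_bigr => j jJ do rewrite (fg _ jJ).
  rewrite -big_seq => <-.
  - apply: eq_mean => w; rewrite big_seq [RHS]big_seq.
    by apply: eq_bigr => j jJ; rewrite fg.
  - by move=> j; rewrite /g; case: ifP => // _; exact: observable_indic.
  - by move=> j; rewrite leqNgt /g => /negbTE ->; exists setT.
elim: m => {f} [|m IH] f of_ fI.
  have /choice[A HA] : forall j, exists A, measurable A /\ f j = \1_A.
    by move=> j; have [A] := fI j isT; exists A.
  have -> : f = fun j => \1_(A j) by apply/funext => j; case: (HA j).
  by apply: mean_prod_indicators => // j; case: (HA j).
have [mJ|mJ] := boolP (m \in J); last first.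
  pose g j := if j == m then \1_setT else f j.
  have fg j : j \in J -> g j = f j.
    by rewrite /g; case: eqP => // -> /idPn; rewrite mJ.
  have := IH g; rewrite [in X in _ -> _ -> _ = X]big_seq.
  under [in X in _ -> _ -> _ = X]eq_bigr => j jJ do rewrite (fg _ jJ).
  rewrite -big_seq => <-.
  - apply: eq_mean => w; rewrite big_seq [RHS]big_seq.
    by apply: eq_bigr => j jJ; rewrite fg.
  - by move=> j; rewrite /g; case: eqP => // _; exact: observable_indic.
  - move=> j mj; rewrite /g; case: eqP => [_|/eqP jm]; first by exists setT.
    by apply: fI; rewrite ltn_neqAle eq_sym jm.
pose G w := \prod_(j <- J | j != m) f j (Y j w).
pose p := \prod_(j <- J | j != m) E (f j \o Y j).
have bG : ess_bounded P G.
  by apply: ess_bounded_prod => j; case: (of_ j).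
have Gind A : measurable A ->
    E (fun w => G w * \1_A (Y m w)) = p * E (\1_A \o Y m).
  move=> mA; pose g j := if j == m then \1_A else f j.
  have gm : g m = \1_A by rewrite /g eqxx.
  have gf j : j != m -> g j = f j by rewrite /g => /negbTE ->.
  have := IH g; rewrite (bigD1_seq m)//= gm mulrC.
  under eq_bigr => j jm do rewrite (gf _ jm).
  move=> <-.
  - apply: eq_mean => w; rewrite (bigD1_seq m)//= gm mulrC.
    by congr (_ * _); apply: eq_bigr => j jm; rewrite gf.
  - by move=> j; rewrite /g; case: eqP => // _; exact: observable_indic.
  - move=> j mj; rewrite /g; case: eqP => [_|/eqP jm]; first by exists A.
    by apply: fI; rewrite ltn_neqAle eq_sym jm.
have [mf bf] := of_ m.
have fG0 : E (fun w => (G w - p) * f m (Y m w)) = 0.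
  apply: orthogonal_to_indicators => //.
    by apply: ess_boundedB => //; exact: ess_bounded_cst.
  move=> A mA; have bA := ess_bounded_indic_comp (Y m) mA.
  transitivity (E (fun w => G w * \1_A (Y m w) - p * (\1_A \o Y m) w)).
    by apply: eq_mean => w /=; ring.
  rewrite meanB ?meanZ ?Gind ?subrr//; last exact: ess_boundedZ.
  exact: ess_boundedM.
rewrite (bigD1_seq m)//= -/p mulrC -meanZ// -[RHS]add0r -fG0.
rewrite -meanD; last 2 first.
- apply: ess_boundedM => //.
  by apply: ess_boundedB => //; exact: ess_bounded_cst.
- exact: ess_boundedZ.
by apply: eq_mean => w; rewrite (bigD1_seq m)//= -/(G w); ring.
Qed.

(** The linear span of the products of bounded functions of [Y 0], ...,
    [Y n.-1]. It is an algebra that contains all polynomials in these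
    observations, and independence of [Y n] from it is a linear statement; so
    it serves in place of measurability with respect to the sigma-algebra
    that the first [n] observations generate. *)
Inductive past (n : nat) : (Omega -> R) -> Prop :=
| past_prod f : (forall j, observable j (f j)) ->
    past n (fun w => \prod_(j <- iota 0 n) f j (Y j w))
| pastD F G : past n F -> past n G -> past n (fun w => F w + G w)
| pastZ c F : past n F -> past n (fun w => c * F w).

Lemma past_bounded n F : past n F -> ess_bounded P F.
Proof.
elim=> [f of_|*|*]; [|exact: ess_boundedD|exact: ess_boundedZ].
by apply: ess_bounded_prod => j; case: (of_ j).
Qed.

Lemma eq_past n F G : F =1 G -> past n F -> past n G.
Proof. by move=> /funext ->. Qed.

Lemma observableM j f g : observable j f -> observable j g ->
  observable j (fun y => f y * g y).
Proof.
move=> [mf bf] [mg bg]; split; first exact: measurable_funM.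
exact: ess_boundedM bf bg.
Qed.

Lemma pastM n F G : past n F -> past n G -> past n (fun w => F w * G w).
Proof.
elim=> [f of_|F1 F2 _ IH1 _ IH2|c F1 _ IH] pG.
- elim: pG => [g og|G1 G2 _ IH1 _ IH2|c G1 _ IH].
  + apply: eq_past (past_prod n (fun j => observableM (of_ j) (og j))) => w.
    by rewrite big_split.
  + by apply: eq_past (pastD IH1 IH2) => w; rewrite mulrDr.
  + by apply: eq_past (pastZ c IH) => w; rewrite mulrCA.
- by apply: eq_past (pastD (IH1 pG) (IH2 pG)) => w; rewrite mulrDl.
- by apply: eq_past (pastZ c (IH pG)) => w; rewrite mulrA.
Qed.

Lemma observable_cst j c : observable j (cst c).
Proof. by split; [exact: measurable_cst | exact: ess_bounded_cst]. Qed.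

Lemma past_step n F g : past n F -> observable n g ->
  past n.+1 (fun w => F w * g (Y n w)).
Proof.
move=> pF og; elim: pF => [f of_|F1 F2 _ IH1 _ IH2|c F1 _ IH].
- pose h j := if j == n then g else f j.
  have oh j : observable j (h j) by rewrite /h; case: eqP => [->|].
  have hn : h n = g by rewrite /h eqxx.
  apply: eq_past (past_prod n.+1 oh) => w.
  rewrite -addn1 iotaD big_cat big_seq1 add0n hn; congr (_ * _).
  rewrite big_seq [RHS]big_seq; apply: eq_bigr => j.
  by rewrite mem_iota add0n => /andP[_ jn]; rewrite /h ltn_eqF.
- by apply: eq_past (pastD IH1 IH2) => w; rewrite mulrDl.
- by apply: eq_past (pastZ c IH) => w; rewrite mulrA.
Qed.

Lemma past_cst n c : past n (fun=> c).
Proof.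
apply: eq_past (pastZ c (past_prod n (fun j => observable_cst j 1))) => w /=.
by rewrite big1 ?mulr1.
Qed.

Lemma past_weaken n F : past n F -> past n.+1 F.
Proof.
by move=> pF; apply: eq_past (past_step pF (observable_cst n 1)) => w; rewrite mulr1.
Qed.

Lemma past_last n g : observable n g -> past n.+1 (g \o Y n).
Proof.
by move=> og; apply: eq_past (past_step (past_cst n 1) og) => w; rewrite mul1r.
Qed.

Lemma past_sum n (I : Type) (r : seq I) (F : I -> Omega -> R) :
  (forall i, past n (F i)) -> past n (fun w => \sum_(i <- r) F i w).
Proof.
move=> pF; elim: r => [|i r IH].
  by under eq_fun do rewrite big_nil; exact: past_cst.
by under eq_fun do rewrite big_cons; exact: pastD.
Qed.

Lemma mean_past_observable n F g :
    mutually_independent Y -> past n F -> observable n g ->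
  E (fun w => F w * g (Y n w)) = E F * E (g \o Y n).
Proof.
move=> indep pF og; have [mg bg] := og.
elim: pF => [f of_|F1 F2 p1 IH1 p2 IH2|c F1 p1 IH].
- pose h j := if j == n then g else f j.
  have oh j : observable j (h j) by rewrite /h; case: eqP => [->|].
  have hn : h n = g by rewrite /h eqxx.
  have hf j : j \in iota 0 n -> h j = f j.
    by rewrite mem_iota add0n => /andP[_ jn]; rewrite /h ltn_eqF.
  transitivity (E (fun w => \prod_(j <- iota 0 n.+1) h j (Y j w))).
    apply: eq_mean => w.
    rewrite -addn1 iotaD big_cat big_seq1 add0n hn; congr (_ * _).
    by rewrite big_seq [RHS]big_seq; apply: eq_bigr => j /hf ->.
  rewrite !mean_prod_independent ?iota_uniq//.
  rewrite -addn1 iotaD big_cat big_seq1 add0n hn; congr (_ * _).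
  by rewrite big_seq [RHS]big_seq; apply: eq_bigr => j /hf ->.
- have b1 := past_bounded p1; have b2 := past_bounded p2.
  rewrite meanD// mulrDl -IH1 -IH2 -meanD; last 2 first.
  + exact: ess_boundedM b1 bg.
  + exact: ess_boundedM b2 bg.
  by apply: eq_mean => w; rewrite mulrDl.
- have b1 := past_bounded p1.
  rewrite meanZ// -mulrA -IH -meanZ; last exact: ess_boundedM b1 bg.
  by apply: eq_mean => w; rewrite mulrA.
Qed.

End Independence.

(** * Second moment of the squared length of the walk *)

Section Moments.
Context {dO dY : measure_display} {Omega : measurableType dO}
  {YY : measurableType dY} {R : realType}.
Variables (P : probability Omega R) (Y : nat -> {RV P >-> YY}).
Variables (l : nat -> YY -> R) (k : nat) (B : R).
Hypotheses (Y_indep : mutually_independent Y)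
  (l_obs : forall i j, observable Y j (l i))
  (l_mean : forall i j, mean P (l i \o Y j) = 0)
  (l_orth : forall i i' j,
    mean P (fun w => l i (Y j w) * l i' (Y j w)) = (i == i')%:R)
  (l_sq : forall j, {ae P, forall w, \sum_(i < k) l i (Y j w) ^+ 2 <= B}).
Notation E := (mean P).

Let l_bd i j : ess_bounded P (l i \o Y j). Proof. by case: (l_obs i j). Qed.

Let l_bd2 i i' j : ess_bounded P (fun w => l i (Y j w) * l i' (Y j w)).
Proof. exact: ess_boundedM (l_bd i j) (l_bd i' j). Qed.

Let l_bdX i j : ess_bounded P (fun w => l i (Y j w) ^+ 2).
Proof. by under eq_fun do rewrite expr2; exact: l_bd2. Qed.

Definition walk (n i : nat) (w : Omega) : R := \sum_(j < n) l i (Y j w).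

Definition walk_sqnorm (n : nat) (w : Omega) : R := \sum_(i < k) walk n i w ^+ 2.

(** The walk has [n] steps of mean squared length [k], so this has mean zero. *)
Definition excess (n : nat) (w : Omega) : R := walk_sqnorm n w - (n * k)%:R.

Definition cross (n : nat) (w : Omega) : R := \sum_(i < k) walk n i w * l i (Y n w).

Definition step_excess (y : YY) : R := \sum_(i < k) l i y ^+ 2 - k%:R.

Lemma excessS n w :
  excess n.+1 w = excess n w + (2 * cross n w + step_excess (Y n w)).
Proof.
rewrite /excess /walk_sqnorm /cross /step_excess mulSn natrD.
have -> : \sum_(i < k) walk n.+1 i w ^+ 2 = \sum_(i < k) walk n i w ^+ 2
    + 2 * \sum_(i < k) walk n i w * l i (Y n w) + \sum_(i < k) l i (Y n w) ^+ 2.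
  rewrite mulr_sumr -!big_split /=; apply: eq_bigr => i _.
  by rewrite /walk big_ord_recr /=; ring.
ring.
Qed.

Lemma past_walk n i : past Y n (walk n i).
Proof.
elim: n => [|n IH].
  by rewrite /walk; under eq_fun do rewrite big_ord0; exact: past_cst.
apply: eq_past (pastD (past_weaken IH) (past_last (l_obs i n))) => w.
by rewrite /walk big_ord_recr.
Qed.

Lemma past_walk_sqnorm n : past Y n (walk_sqnorm n).
Proof.
apply: past_sum => i.
by apply: eq_past (pastM (past_walk n i) (past_walk n i)) => w; rewrite expr2.
Qed.

Lemma past_excess n : past Y n (excess n).
Proof.
apply: eq_past (pastD (past_walk_sqnorm n) (past_cst _ _ (- (n * k)%:R))) => w.
by [].
Qed.

Lemma observable_pair i i' j : observable Y j (fun y => l i y * l i' y).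
Proof. exact: observableM. Qed.

Lemma observable_step_excess j : observable Y j step_excess.
Proof.
split.
  by apply: measurable_funB => //; apply: measurable_sum => i;
    apply: measurable_funX; case: (l_obs i j).
apply: ess_boundedB; last exact: ess_bounded_cst.
by apply: ess_bounded_sum => i; exact: l_bdX.
Qed.

Lemma cross_bounded n : ess_bounded P (cross n).
Proof.
apply: ess_bounded_sum => i.
exact: ess_boundedM (past_bounded (past_walk n i)) (l_bd i n).
Qed.

Lemma mean_sqnorm j : E (fun w => \sum_(i < k) l i (Y j w) ^+ 2) = k%:R.
Proof.
rewrite mean_sum// (eq_bigr (fun=> 1)) => [|i _]; first by rewrite sumr_const card_ord.
by under eq_mean do rewrite expr2; rewrite l_orth eqxx.
Qed.

Lemma sqnorm_bounded j : ess_bounded P (fun w => \sum_(i < k) l i (Y j w) ^+ 2).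
Proof.
by apply: ess_bounded_sum => i; exact: l_bdX.
Qed.

Lemma mean_step_excess j : E (step_excess \o Y j) = 0.
Proof.
rewrite [LHS]meanB ?mean_sqnorm ?mean_cst ?subrr//; first exact: sqnorm_bounded.
exact: ess_bounded_cst.
Qed.

(** The last step is centred and independent of all the rest. *)
Lemma mean_past_cross n F : past Y n F -> E (fun w => F w * cross n w) = 0.
Proof.
move=> pF; transitivity (E (fun w => \sum_(i < k) (F w * walk n i w) * l i (Y n w))).
  by apply: eq_mean => w; rewrite mulr_sumr; apply: eq_bigr => i _; rewrite mulrA.
have pFw i := pastM pF (past_walk n i).
rewrite mean_sum; last first.
  by move=> i; exact: ess_boundedM (past_bounded (pFw i)) (l_bd i n).
rewrite big1// => i _.
by rewrite [LHS](mean_past_observable Y_indep (pFw i) (l_obs i n)) l_mean mulr0.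
Qed.

Lemma mean_excess n : E (excess n) = 0.
Proof.
elim: n => [|n IH].
  rewrite -[RHS](mean_cst P 0); apply: eq_mean => w; rewrite /excess /walk_sqnorm mul0n subr0.
  by rewrite big1// => i _; rewrite /walk big_ord0 expr0n.
have [_ bs] := observable_step_excess n.
have bc := cross_bounded n.
have bx := past_bounded (past_excess n).
under eq_mean do rewrite excessS.
rewrite meanD//; last by apply: ess_boundedD => //; exact: ess_boundedZ.
rewrite IH add0r meanD//; last exact: ess_boundedZ.
rewrite [X in _ + X]mean_step_excess addr0 meanZ//.
have := mean_past_cross (past_cst Y n 1).
under eq_mean do rewrite mul1r.
by move=> ->; rewrite mulr0.
Qed.

Lemma mean_walk_sqnorm n : E (walk_sqnorm n) = (n * k)%:R.
Proof.
have := mean_excess n; rewrite [X in X = 0 -> _]meanB ?mean_cst.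
- by move/eqP; rewrite subr_eq0 => /eqP.
- exact: past_bounded (past_walk_sqnorm n).
- exact: ess_bounded_cst.
Qed.

(** Given the past, the last step has identity covariance, so the mean
    square of its scalar product with the walk is the mean squared length of
    the walk. *)
Lemma mean_cross_sq n : E (fun w => cross n w ^+ 2) = (n * k)%:R.
Proof.
have pww i i' := pastM (past_walk n i) (past_walk n i').
transitivity (E (fun w => \sum_(i < k) \sum_(i' < k)
    (walk n i w * walk n i' w) * (l i (Y n w) * l i' (Y n w)))).
  apply: eq_mean => w; rewrite expr2 /cross mulr_suml; apply: eq_bigr => i _.
  by rewrite mulr_sumr; apply: eq_bigr => i' _; ring.
have bt i i' : ess_bounded P
    (fun w => (walk n i w * walk n i' w) * (l i (Y n w) * l i' (Y n w))).
  exact: ess_boundedM (past_bounded (pww i i')) (l_bd2 i i' n).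
rewrite mean_sum; last by move=> i; exact: ess_bounded_sum.
rewrite -mean_walk_sqnorm mean_sum; last first.
  by move=> i; under eq_fun do rewrite expr2; exact: past_bounded (pww i i).
apply: eq_bigr => i _; rewrite mean_sum//.
have term (i' : 'I_k) : E (fun w => walk n i w * walk n i' w * (l i (Y n w) * l i' (Y n w)))
   = E (fun w => walk n i w * walk n i' w) * (i == i')%:R.
  rewrite -(l_orth i i' n).
  exact: (mean_past_observable Y_indep (pww i i') (observable_pair i i' n)).
rewrite (bigD1 i)//= term eqxx mulr1 big1 ?addr0.
  by apply: eq_mean => w; rewrite expr2.
by move=> i' ii'; rewrite term eq_sym (negbTE ii') mulr0.
Qed.

(** With [s] the squared length of a step, [s <= B] gives [s^2 <= B s], which
    is linear in [s]. This is the only place where the bound on the steps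
    enters quantitatively. *)
Lemma mean_step_excess_sq j : E (fun w => step_excess (Y j w) ^+ 2) <= B * k%:R.
Proof.
have bS := sqnorm_bounded j.
set S := (fun w => \sum_(i < k) l i (Y j w) ^+ 2) in bS *.
apply: (@le_trans _ _ (E (fun w => (B - 2 * k%:R) * S w + k%:R ^+ 2))).
  apply: mean_le.
  - have [_ b] := observable_step_excess j.
    by under eq_fun do rewrite expr2; exact: ess_boundedM.
  - by apply: ess_boundedD; [exact: ess_boundedZ | exact: ess_bounded_cst].
  - apply: filterS (l_sq j) => w SB; rewrite /step_excess -/(S w).
    have S0 : 0 <= S w by apply: sumr_ge0 => i _; exact: sqr_ge0.
    have : S w * S w <= B * S w by rewrite ler_wpM2r.
    by rewrite -/(S w) in SB *; nra.
rewrite meanD; [|exact: ess_boundedZ|exact: ess_bounded_cst].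
rewrite meanZ// mean_cst [E S]mean_sqnorm.
have : 0 <= (k%:R : R) by [].
nra.
Qed.

(** Square the recurrence [excessS]. The increment is uncorrelated with
    [excess n], and its square [(2 V + U)^2] is at most [8 V^2 + 2 U^2], with
    means computed above; the right-hand side grows by at least their sum. *)
Lemma mean_excess_sq n : E (fun w => excess n w ^+ 2) <=
  4 * k%:R * n%:R ^+ 2 + 2 * B * k%:R * n%:R.
Proof.
elim: n => [|n IH].
  rewrite (_ : E _ = 0) ?mulr0 ?expr0n ?mulr0 ?addr0//.
  rewrite -[RHS](mean_cst P 0); apply: eq_mean => w; rewrite /excess /walk_sqnorm mul0n subr0.
  by rewrite big1 ?expr0n// => i _; rewrite /walk big_ord0 expr0n.
have px := past_excess n.
have bx := past_bounded px.
have bc := cross_bounded n.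
have os := observable_step_excess n.
have [_ bs] := os.
pose D := excess n; pose V := cross n; pose U := step_excess \o Y n.
have bDD : ess_bounded P (fun w => D w * D w) by exact: ess_boundedM.
have bDV : ess_bounded P (fun w => D w * V w) by exact: ess_boundedM.
have bDU : ess_bounded P (fun w => D w * U w) by exact: ess_boundedM.
have bVV : ess_bounded P (fun w => V w * V w) by exact: ess_boundedM.
have bUU : ess_bounded P (fun w => U w * U w) by exact: ess_boundedM.
have DV0 : E (fun w => D w * V w) = 0 by exact: mean_past_cross.
have DU0 : E (fun w => D w * U w) = 0.
  by rewrite [LHS](mean_past_observable Y_indep px os) mean_step_excess mulr0.
have VVE : E (fun w => V w * V w) = (n * k)%:R.
  by rewrite -mean_cross_sq; apply: eq_mean => w; rewrite expr2.
have UUE : E (fun w => U w * U w) <= B * k%:R.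
  apply: le_trans (mean_step_excess_sq n).
  by rewrite le_eqVlt (_ : E _ = E (fun w => step_excess (Y n w) ^+ 2)) ?eqxx.
have DDE : E (fun w => D w * D w) <= 4 * k%:R * n%:R ^+ 2 + 2 * B * k%:R * n%:R.
  by apply: le_trans IH.
apply: (@le_trans _ _ (E (fun w => D w * D w
   + (4 * (D w * V w) + (2 * (D w * U w) + (8 * (V w * V w) + 2 * (U w * U w))))))).
  apply: mean_le.
  - have b := past_bounded (past_excess n.+1).
    by under eq_fun do rewrite expr2; exact: ess_boundedM.
  - by repeat (apply: ess_boundedD => //); exact: ess_boundedZ.
  - apply: aeW => w; rewrite excessS -/(D w) -/(V w) -[step_excess _]/(U w).
    have : 0 <= (2 * V w - U w) ^+ 2 by exact: sqr_ge0.
    nra.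
repeat (rewrite meanD; [|by [] || exact: ess_boundedZ
  |by repeat (apply: ess_boundedD => //); exact: ess_boundedZ]).
rewrite !meanZ// DV0 DU0 !mulr0 !add0r VVE.
have n0 : 0 <= (n%:R : R) by [].
have k0 : 0 <= (k%:R : R) by [].
rewrite natrM -(natr1 n); nra.
Qed.

(** Chebyshev's inequality around the mean [k]. *)
Lemma walk_sqnorm_tail n t : (0 < n)%N -> k%:R < t ->
  (P [set w | (t <= walk_sqnorm n w / n%:R)%R]
    <= ((4 * k%:R + 2 * k%:R * (B / n%:R)) / (t - k%:R) ^+ 2)%:E)%E.
Proof.
move=> n0 kt.
have n0' : 0 < n%:R :> R by rewrite ltr0n.
have bx : ess_bounded P (fun w => excess n w ^+ 2).
  have b := past_bounded (past_excess n).
  by under eq_fun do rewrite expr2; exact: ess_boundedM.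
pose c := (n%:R * (t - k%:R)) ^+ 2.
have c0 : 0 < c by rewrite exprn_gt0// mulr_gt0// subr_gt0.
have mA : measurable [set w | t <= walk_sqnorm n w / n%:R].
  rewrite -[X in measurable X]setTI.
  apply: (@measurable_fun_le _ _ _ setT (cst t) (fun w => _)) => //.
  have [mq _] := past_bounded (past_walk_sqnorm n).
  exact: measurable_funM.
apply: le_trans (markov_mean mA c0 bx _ _) _.
- by move=> w; exact: sqr_ge0.
- move=> w /=; rewrite ler_pdivlMr// => tQ.
  have t0 : 0 <= n%:R * (t - k%:R) by rewrite mulr_ge0 ?subr_ge0 ?ltW.
  apply: ler_pM => //; rewrite ?lexx// /excess natrM mulrBr lerB// mulrC//.
- rewrite lee_fin /c exprMn ler_pdivrMr; last by rewrite -exprMn.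
  apply: le_trans (mean_excess_sq n) _.
  rewrite le_eqVlt; apply/orP; left; apply/eqP.
  by field; rewrite !gt_eqF// subr_gt0.
Qed.

Lemma walk_sqnorm_markov n t : (0 < n)%N -> 0 < t ->
  (P [set w | (t <= walk_sqnorm n w / n%:R)%R] <= (k%:R / t)%:E)%E.
Proof.
move=> n0 t0.
have n0' : 0 < n%:R :> R by rewrite ltr0n.
have bq := past_bounded (past_walk_sqnorm n).
have mA : measurable [set w | t <= walk_sqnorm n w / n%:R].
  rewrite -[X in measurable X]setTI.
  apply: (@measurable_fun_le _ _ _ setT (cst t) (fun w => _)) => //.
  by case: bq => mq _; exact: measurable_funM.
apply: le_trans (markov_mean mA (mulr_gt0 t0 n0') bq _ _) _.
- by move=> w; apply: sumr_ge0 => i _; exact: sqr_ge0.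
- by move=> w /=; rewrite ler_pdivlMr.
- rewrite mean_walk_sqnorm lee_fin natrM invfM.
  rewrite le_eqVlt; apply/orP; left; apply/eqP.
  by field; rewrite !gt_eqF.
Qed.

End Moments.

(** * The selection rule *)

Section Selection.
Context {dO : measure_display} {Omega : measurableType dO} {R : realType}.
Variables (d : nat -> nat) (pen : nat -> nat -> R) (T : nat -> nat -> Omega -> R).
Hypothesis mT : forall k n, measurable_fun setT (T k n).

Lemma measurable_optimal_dim n k : measurable_fun setT (fun w => optimal_dim d pen T n w k).
Proof.
rewrite /optimal_dim; elim: (iota _ _) => [|j s IH] /=; first exact: measurable_cst.
by apply: measurable_and => //; apply: measurable_fun_ler;
  exact: measurable_funB.
Qed.

Lemma measurable_fun_selection (F : nat -> Omega -> R) n :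
    (forall k, measurable_fun setT (F k)) ->
  measurable_fun setT (fun w => F (selection d pen T n w) w).
Proof.
move=> mF; rewrite /selection; elim: (iota _ _) => [|k s IH] //=.
rewrite (_ : (fun w => _) = fun w => if optimal_dim d pen T n w k then F k w
    else F (head 0%N [seq j <- s | optimal_dim d pen T n w j]) w).
  by apply: measurable_fun_ifT => //; exact: measurable_optimal_dim.
by apply/funext => w; case: ifP.
Qed.

Lemma measurable_exceeds (F : Omega -> R) (c : R) : measurable_fun setT F ->
  measurable [set w | c <= F w].
Proof.
move=> mF; rewrite -[X in measurable X]setTI.
exact: (@measurable_fun_le _ _ _ setT (cst c) F).
Qed.

(** Dimension 1 has a nonnegative statistic and is beaten by the selected
    one, which must pay for its larger penalty. *)
Lemma selection_ge (n : nat) (w : Omega) : (0 < d n)%N ->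
    (forall k, (2 <= k)%N -> (2 * k)%:R <= pen k n - pen 1%N n) ->
    0 <= T 1 n w -> (2 <= selection d pen T n w)%N ->
  (2 * selection d pen T n w)%:R <= T (selection d pen T n w) n w.
Proof.
move=> dn pen_ge T1 S2.
have [_ /(_ 1%N) opt _] := selection_spec pen T w dn.
have := opt _; rewrite dn => /(_ isT); have := pen_ge _ S2.
by move: (T _ n w) (pen _ n) (pen 1%N n) T1 => x y z; lra.
Qed.

End Selection.

Lemma square_block (k : nat) : exists m, (m * m <= k < m.+1 * m.+1)%N.
Proof.
elim: k => [|k [m /andP[mk km]]]; first by exists 0%N.
have [h|h] := ltnP k.+1 (m.+1 * m.+1); first by exists m; rewrite h andbT; lia.
by exists m.+1; rewrite h /=; nia.
Qed.

(** Comparison with the telescoping sum of [1/(x-1) - 1/x]. *)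
Lemma sum_inv_sqr (R : realType) (m N : nat) : (2 <= m)%N ->
  \sum_(i < N) ((m + i)%:R ^+ 2)^-1 <= (m.-1)%:R^-1 :> R.
Proof.
move=> m2; suff h : \sum_(i < N) ((m + i)%:R ^+ 2)^-1 <=
    (m.-1)%:R^-1 - ((m + N).-1)%:R^-1 :> R.
  by apply: le_trans h _; rewrite gerBl invr_ge0.
elim: N => [|N IH]; first by rewrite big_ord0 addn0 subrr.
rewrite big_ord_recr /=; apply: le_trans (lerD IH (lexx _)) _.
rewrite -addrA lerD2l addnS /=.
case: m m2 {IH} => [|m] //= m2; rewrite addSn /= -natr1.
have : (0 : R) < (m + N)%:R by rewrite ltr0n; lia.
move: (_%:R) => x x0.
rewrite -subr_ge0 (_ : _ - _ = (x * (x + 1) ^+ 2)^-1); last by field; lra.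
by rewrite invr_ge0 mulr_ge0 ?sqr_ge0 ?ltW.
Qed.

(** * The statistic as a normalized random walk *)

Section NT.
Context {dO dY : measure_display} {Omega : measurableType dO}
  {YY : measurableType dY} {R : realType}.
Variables (P : probability Omega R) (Y : nat -> {RV P >-> YY})
  (l : nat -> {mfun YY >-> R}).
Local Notation Q k n := (walk_sqnorm Y l k n).
Local Notation sq k := (fun y : YY => \sum_(i < k) l i y ^+ 2).

Lemma euclidean_norm_lvec k y : euclidean_norm (lvec l k y) = Num.sqrt (sq k y).
Proof. by congr Num.sqrt; apply: eq_bigr => i _; rewrite mxE. Qed.

Lemma NT_walk k n w : second_moment Y l k = 1%:M ->
  NT Y l k n w = Q k n w / n%:R.
Proof.
move=> sm1; rewrite /NT /NT_L sm1 invmx1 mulmx1 mxE.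
rewrite /walk_sqnorm mulr_suml; apply: eq_bigr => i _.
rewrite !mxE summxE; under eq_bigr do rewrite mxE.
rewrite -/(walk Y l n i w) mulrACA -expr2 -expr2 exprVn sqr_sqrtr//.
by rewrite mulrC.
Qed.

Lemma sum_sqr_widen (F : nat -> R) k k' : (k <= k')%N ->
  \sum_(i < k) F i ^+ 2 <= \sum_(i < k') F i ^+ 2.
Proof.
move=> kk'; rewrite -!(big_mkord xpredT (fun i => F i ^+ 2)).
rewrite [leRHS](big_cat_nat (leq0n k) kk')/= lerDl.
by apply: sumr_ge0 => i _; exact: sqr_ge0.
Qed.

End NT.

(** * Transfer between identically distributed observations *)

Section Transfer.
Context {dO dY : measure_display} {Omega : measurableType dO}
  {YY : measurableType dY} {R : realType}.
Variables (P : probability Omega R) (Y : nat -> {RV P >-> YY}).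
Hypothesis Y_id : identically_distributed Y.

Lemma ae_identically_distributed (A : set YY) (i j : nat) : measurable A ->
  {ae P, forall w, A (Y i w)} -> {ae P, forall w, A (Y j w)}.
Proof.
move=> mA.
have mY k : measurable (~` (Y k @^-1` A)).
  by apply: measurableC; rewrite -[X in measurable X]setTI; exact: measurable_funPT.
move=> /(negligibleP P (mY i)) h; apply/(negligibleP P (mY j)).
by rewrite -h; exact: Y_id (measurableC mA).
Qed.

Lemma mean_identically_distributed (f : YY -> R) (i j : nat) :
  observable Y i f -> observable Y j f -> mean P (f \o Y i) = mean P (f \o Y j).
Proof.
move=> [mf bi] [_ bj].
have mf' : measurable_fun setT (EFin \o f) by exact/measurable_EFinP.
congr fine; rewrite -[LHS](integral_distribution (f := EFin \o f))//; last first.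
  exact: ess_bounded_integrable bi.
rewrite -[RHS](integral_distribution (f := EFin \o f))//; last first.
  exact: ess_bounded_integrable bj.
by apply: eq_measure_integral => A mA _; exact: Y_id.
Qed.

End Transfer.

(** * Tails of the selected dimension and of its statistic *)

Section SelectionTail.
Context {dO dY : measure_display} {Omega : measurableType dO}
  {YY : measurableType dY} {R : realType}.
Variables (P : probability Omega R) (Y : nat -> {RV P >-> YY}).
Variables (l : nat -> YY -> R) (d : nat -> nat) (pen : nat -> nat -> R).
Hypotheses (Y_indep : mutually_independent Y)
  (l_obs : forall i j, observable Y j (l i))
  (l_mean : forall i j, mean P (l i \o Y j) = 0)
  (l_orth : forall i i' j,
    mean P (fun w => l i (Y j w) * l i' (Y j w)) = (i == i')%:R)
  (pen_ge : forall k n, (2 <= k)%N -> (0 < n)%N ->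
    (2 * k)%:R <= pen k n - pen 1%N n).

Let T k n w := walk_sqnorm Y l k n w / n%:R.
Let S := selection d pen T.

Lemma statistic_ge0 k n w : 0 <= T k n w.
Proof. by rewrite divr_ge0// sumr_ge0// => i _; exact: sqr_ge0. Qed.

Lemma statistic_monotone k k' n w : (k <= k')%N -> T k n w <= T k' n w.
Proof.
move=> kk'; rewrite ler_wpM2r ?invr_ge0//.
exact: sum_sqr_widen (fun i => walk Y l n i w) _ _ kk'.
Qed.

Lemma measurable_statistic k n : measurable_fun setT (T k n).
Proof.
by apply: measurable_funM => //; have [] := past_bounded (past_walk_sqnorm k l_obs n).
Qed.

Lemma measurable_selection_ge (K n : nat) : measurable [set w | (K <= S n w)%N].
Proof.
rewrite (_ : [set w | _] = [set w | (K%:R : R) <= (S n w)%:R]).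
  apply: measurable_exceeds.
  exact: (@measurable_fun_selection _ _ _ d pen T measurable_statistic (fun k _ => k%:R)).
by apply/seteqP; split => w /=; rewrite ler_nat.
Qed.

(** Dimensions are grouped into the blocks between consecutive squares; by
    monotonicity each block costs a single event. *)
Lemma selection_tail (B : R) (m n : nat) :
    (0 < n)%N -> (0 < d n)%N -> B / n%:R <= 1 -> (4 <= m)%N ->
    (forall j, {ae P, forall w, \sum_(i < d n) l i (Y j w) ^+ 2 <= B}) ->
  (P [set w | (m * m <= S n w)%N] <= (36 / (m.-1)%:R)%:E)%E.
Proof.
move=> n0 dn Bn m4 l_sq.
(* [b i] is the last dimension of the block that starts at [(m + i)^2], cut at
   [d n] because the bound [B] is available only up to there. *)
pose b i := minn ((m + i) * (m + i) + 2 * (m + i)) (d n).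
pose A i := [set w | (2 * ((m + i) * (m + i)))%:R <= T (b i) n w].
have mA i : measurable (A i) by apply: measurable_exceeds; exact: measurable_statistic.
have PA i : (P (A i) <= (36 * ((m + i)%:R ^+ 2)^-1)%:E)%E.
  have l_sq' j : {ae P, forall w, \sum_(i0 < b i) l i0 (Y j w) ^+ 2 <= B}.
    apply: filterS (l_sq j) => w; apply: le_trans.
    by apply: (sum_sqr_widen (fun i => l i (Y j w))); exact: geq_minr.
  have bx : (b i <= (m + i) * (m + i) + 2 * (m + i))%N by exact: geq_minl.
  have x4 : (4 <= m + i)%N by lia.
  rewrite /A; move: (m + i)%N (b i) bx x4 l_sq' => x k kx x4 l_sq'.
  have X4 : (4 : R) <= x%:R by rewrite ler_nat.
  have KX : k%:R <= x%:R * x%:R + 2 * x%:R :> R by rewrite -!natrM -natrD ler_nat.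
  have kt : k%:R < (2 * (x * x))%:R :> R by rewrite ltr_nat; nia.
  apply: le_trans (walk_sqnorm_tail Y_indep l_obs l_mean l_orth l_sq' n0 kt) _.
  rewrite lee_fin; have k0 : (0 : R) <= k%:R by [].
  move: kt; rewrite !natrM; move: (x%:R : R) (k%:R : R) (B / _) X4 KX k0 Bn
    => y r c X4 KX k0 c1 kt.
  (* For [y >= 4] the threshold [2 y^2] exceeds the mean [r <= y^2 + 2 y] by at
     least [y (y - 2)]. *)
  have den : y * (y - 2) <= 2 * (y * y) - r by lra.
  have y2 : 0 < y * (y - 2) by nra.
  apply: (@le_trans _ _ ((6 * r) / (2 * (y * y) - r) ^+ 2)).
    by rewrite ler_wpM2r ?invr_ge0 ?sqr_ge0//; nra.
  have den0 : 0 < 2 * (y * y) - r by lra.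
  rewrite ler_pdivrMr ?exprn_gt0// mulrAC ler_pdivlMr; last by nra.
  apply: (@le_trans _ _ (36 * (y * (y - 2)) ^+ 2)); last first.
    by rewrite ler_wpM2l// lerXn2r// nnegrE ltW.
  apply: (@le_trans _ _ (6 * (y * y + 2 * y) * y ^+ 2)).
    by rewrite ler_wpM2r ?sqr_ge0//; lra.
  have -> : 36 * (y * (y - 2)) ^+ 2 = 36 * (y - 2) ^+ 2 * y ^+ 2 by ring.
  by rewrite ler_wpM2r ?sqr_ge0//; nra.
have sub : [set w | (m * m <= S n w)%N] `<=` \big[setU/set0]_(i < (d n).+1) A i.
  move=> w /= mS; rewrite -bigcup_mkord.
  have [/andP[_ Sd] _ _] := selection_spec pen T w dn.
  have [x /andP[xS Sx]] := square_block (S n w).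
  rewrite -/(S n w) in Sd.
  have mx : (m <= x)%N by rewrite leqNgt; apply/negP => ?; nia.
  exists (x - m)%N => /=; first by nia.
  rewrite /A /b /= subnKC//.
  apply: le_trans (_ : (2 * S n w)%:R <= _); first by rewrite ler_nat; lia.
  apply: le_trans (selection_ge dn (fun k hk => pen_ge hk n0) (statistic_ge0 1 n w) _) _.
    by rewrite -/(S n w); nia.
  apply: statistic_monotone; rewrite -/(S n w) leq_min Sd andbT; lia.
apply: le_trans (content_subadditive P (fun i _ => mA i) (measurable_selection_ge _ _) sub) _.
apply: (@le_trans _ _ (\sum_(i < (d n).+1) (36 * ((m + i)%:R ^+ 2)^-1)%:E)%E).
  by apply: lee_sum => i _; exact: PA.
rewrite sumEFin lee_fin -mulr_sumr ler_wpM2l// sum_inv_sqr//; lia.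
Qed.

(** Where [S < K], the selected statistic is dominated by the fixed one of
    dimension [K], to which Markov's inequality applies. *)
Lemma selected_statistic_tail (K n : nat) (t : R) : (0 < n)%N -> 0 < t ->
  (P [set w | (t < `|T (S n w) n w|)%R] <=
    P [set w | (K <= S n w)%N] + (K%:R / t)%:E)%E.
Proof.
move=> n0 t0.
have mTS : measurable_fun setT (fun w => T (S n w) n w).
  apply: (@measurable_fun_selection _ _ _ d pen T measurable_statistic (fun k w => T k n w)) => k.
  exact: measurable_statistic.
have mTK : measurable [set w | t <= T K n w].
  by apply: measurable_exceeds; exact: measurable_statistic.
apply: le_trans (_ : P ([set w | (K <= S n w)%N] `|` [set w | (t <= T K n w)%R]) <= _)%E.
  apply: le_measure; rewrite ?inE.
  - rewrite (_ : [set w | _] = ~` [set w | `|T (S n w) n w| <= t]).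
      apply: measurableC; rewrite -[X in measurable X]setTI.
      apply: (@measurable_fun_le _ _ _ setT (fun w => `|T (S n w) n w|) (cst t)) => //.
      exact: measurableT_comp.
    by apply/seteqP; split => w /=; rewrite ltNge => /negP.
  - by apply: measurableU => //; exact: measurable_selection_ge.
  - move=> w /=; rewrite ger0_norm ?statistic_ge0// => tT.
    have [?|SK] := leqP K (S n w); [by left|right].
    by apply: le_trans (ltW tT) _; apply: statistic_monotone; exact: ltnW.
apply: le_trans (measureU2 _ _ _) _ => //; first exact: measurable_selection_ge.
by rewrite leeD2l// walk_sqnorm_markov.
Qed.

End SelectionTail.

(** * Boundedness in probability *)

Theorem proposition2 (R : realType) (dO dY : measure_display)
    (Omega : measurableType dO) (YY : measurableType dY)
    (P0 : probability Omega R) (Y : nat -> {RV P0 >-> YY})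
    (l : nat -> {mfun YY >-> R})
    (d : nat -> nat) (pen : nat -> nat -> R) (M : nat -> R)
    (Y_iid : iid Y)
    (d_pos : forall n : nat, (0 < n)%N -> (0 < d n)%N)
    (d_infty : d n @[n --> \oo] --> \oo)
    (pen_penalty : is_penalty d pen)
    (pen_ge0 : forall n : nat, (0 < n)%N -> 0 <= pen 1%N n)
    (l_mean0 : forall i : nat, ('E_P0[l i \o Y 0%N] = 0)%E)
    (l_cov : forall (j k : nat) (a b : 'I_k),
        covariance P0 (l a \o Y j) (l b \o Y j) = (a == b)%:R%:E)
    (l_bound : forall k : nat, (0 < k)%N ->
        {ae P0, forall w, euclidean_norm (lvec l k (Y 0%N w)) <= M k})
    (pen_lower : forall k n : nat, (2 <= k)%N -> (0 < n)%N ->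
        (2 * k)%:R <= pen k n - pen 1%N n)
    (pen_limit :
        M (d n) * pen (d n) n / Num.sqrt n%:R @[n --> \oo] --> (0 : R)) :
  let T := NT Y l in
  let S := selection d pen T in
  bounded_in_probability P0 (fun n w => (S n w)%:R) /\
  bounded_in_probability P0 (fun n w => T (S n w) n w).
Proof.
have [Y_indep Y_id] := Y_iid.
have norm_lvec k y : euclidean_norm (lvec l k y) =
    Num.sqrt (\sum_(i < k) l i y ^+ 2) by exact: euclidean_norm_lvec.
(* A bound on a norm that holds almost everywhere holds somewhere. *)
have M_ge0 k : (0 < k)%N -> 0 <= M k.
  move=> k0; apply: contrapT => /negP; rewrite -ltNge => Mk.
  have PT : (0 < P0 setT)%E by rewrite probability_setT.
  have pf : ProperFilter (almost_everywhere P0) by exact: ae_properfilter_algebraOfSetsType.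
  have /filter_ex[w] := l_bound k k0.
  by apply/negP; rewrite -ltNge (lt_le_trans Mk)// sqrtr_ge0.
have l_sq k j : (0 < k)%N ->
    {ae P0, forall w, \sum_(i < k) l i (Y j w) ^+ 2 <= M k ^+ 2}.
  move=> k0; apply: (@ae_identically_distributed _ _ _ _ _ _ _ Y_id
    [set y | \sum_(i < k) l i y ^+ 2 <= M k ^+ 2] 0%N).
    rewrite -[X in measurable X]setTI.
    apply: (@measurable_fun_le _ _ _ setT (fun y => \sum_(i < k) l i y ^+ 2) (cst _)) => //.
    by apply: measurable_sum => i; exact: measurable_funX.
  apply: filterS (l_bound k k0) => w /=; rewrite norm_lvec => h.
  rewrite -[leLHS]sqr_sqrtr; last by apply: sumr_ge0 => i _; exact: sqr_ge0.
  by rewrite lerXn2r// nnegrE ?sqrtr_ge0// M_ge0.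
have l_obs i j : observable Y j (l i).
  split => //; split; first exact: measurableT_comp.
  exists (M i.+1); apply: filterS (l_sq i.+1 j isT) => w.
  rewrite big_ord_recr/= => h.
  rewrite -(@ler_pXn2r _ 2) ?nnegrE ?M_ge0// real_normK ?num_real//.
  by apply: le_trans h; rewrite lerDr sumr_ge0// => i' _; exact: sqr_ge0.
have l_mean i j : mean P0 (l i \o Y j) = 0.
  rewrite (mean_identically_distributed Y_id (l_obs i j) (l_obs i 0%N)).
  by rewrite -mean_fine l_mean0.
have l_orth i i' j :
    mean P0 (fun w => l i (Y j w) * l i' (Y j w)) = (i == i')%:R.
  have hi : (i < (maxn i i').+1)%N by rewrite ltnS leq_maxl.
  have hi' : (i' < (maxn i i').+1)%N by rewrite ltnS leq_maxr.
  have /(congr1 fine) := l_cov j _ (Ordinal hi) (Ordinal hi').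
  rewrite [in X in X -> _]unlock !mean_fine /= -val_eqE /= => <-.
  by apply: eq_mean => w /=; rewrite !mulrfctE /= !l_mean !subr0.
have sm1 k : second_moment Y l k = 1%:M.
  apply/matrixP => a b; rewrite !mxE mean_fine -val_eqE /= -(l_orth a b 0%N).
  by apply: eq_mean => w; rewrite !mxE big_ord1 !mxE.
move=> T S.
have TE : T = fun k n w => walk_sqnorm Y l k n w / n%:R.
  by apply/funext => k; apply/funext => n; apply/funext => w; exact: NT_walk.
have near_n : \forall n \near \oo,
    [/\ (0 < n)%N, (0 < d n)%N & M (d n) ^+ 2 / n%:R <= 1].
  have d2 : \forall n \near \oo, (2 <= d n)%N.
    exact: d_infty (nbhs_infty_ge 2).
  have small : \forall n \near \oo, `|M (d n) * pen (d n) n / Num.sqrt n%:R| < 1.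
    have /cvgrPdist_lt/(_ 1 ltr01) := pen_limit.
    by apply: filterS => n; rewrite sub0r normrN.
  near=> n.
  (* Once [d n >= 2] the penalty is at least 1, so [M (d n) / sqrt n] is smaller
     than the quantity that tends to 0. *)
  have n0 : (0 < n)%N by near: n; exact: nbhs_infty_gt.
  have dn2 : (2 <= d n)%N by near: n.
  split=> //; first exact: ltnW.
  have s : `|M (d n) * pen (d n) n / Num.sqrt n%:R| < 1 by near: n.
  have pen1 : 1 <= pen (d n) n.
    have := pen_lower _ _ dn2 n0; have := pen_ge0 _ n0.
    have : (1 : R) <= (2 * d n)%:R by rewrite ler1n; lia.
    by move: (pen _ _) (pen _ _) (_%:R) => x y z; lra.
  have M0 : 0 <= M (d n) by apply: M_ge0; exact: ltnW.
  have n0' : 0 < n%:R :> R by rewrite ltr0n.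
  have q0 : 0 < Num.sqrt n%:R :> R by rewrite sqrtr_gt0.
  move: s; rewrite ger0_norm; last first.
    by rewrite divr_ge0 ?(ltW q0)// mulr_ge0// (le_trans ler01 pen1).
  rewrite ltr_pdivrMr// mul1r => s.
  have Mq : M (d n) <= Num.sqrt n%:R.
    by apply: le_trans (ltW s); rewrite ler_peMr.
  rewrite ler_pdivrMr// mul1r -[leRHS]sqr_sqrtr ?(ltW n0')//.
  by rewrite lerXn2r// nnegrE ?(ltW q0).
have exists_m (eps : R) : 0 < eps -> exists m, (4 <= m)%N /\ 36 / (m.-1)%:R <= eps.
  move=> e0; pose N := Num.bound (36 / eps).
  exists N.+4; split=> //=; rewrite ler_pdivrMr ?ltr0n// mulrC -ler_pdivrMr//.
  apply: le_trans (ltW (archi_boundP _)) _; first by rewrite divr_ge0// ltW.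
  by rewrite ler_nat; rewrite -/N; lia.
have S_tail m n : (4 <= m)%N -> [/\ (0 < n)%N, (0 < d n)%N & M (d n) ^+ 2 / n%:R <= 1] ->
    (P0 [set w | (m * m <= S n w)%N] <= (36 / (m.-1)%:R)%:E)%E.
  move=> m4 [n0 dn0 Bn]; rewrite /S TE.
  by apply: selection_tail Bn m4 _ => // j; exact: l_sq.
split=> eps e0.
  have [m [m4 me]] := exists_m _ e0.
  exists (m * m)%:R; apply: filterS near_n => n hn.
  apply: le_trans (le_trans (S_tail m n m4 hn) _); last by rewrite lee_fin.
  have mS K : measurable [set w | (K <= S n w)%N].
    by rewrite /S TE; exact: measurable_selection_ge.
  have -> : [set w | (m * m)%:R < `|(S n w)%:R : R|] = [set w | (m * m < S n w)%N].
    by apply/seteqP; split => w /=; rewrite normr_nat ltr_nat.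
  by apply: le_measure; rewrite ?inE//; move=> w /=; exact: ltnW.
have e2 : 0 < eps / 2 by rewrite divr_gt0.
have [m [m4 me]] := exists_m _ e2.
have K0 : 0 < (m * m)%:R :> R by rewrite ltr0n; nia.
(* Half of [eps] pays for [S >= m^2] and half for Markov's inequality. *)
exists ((m * m)%:R / (eps / 2)); apply: filterS near_n => n hn.
have [n0 _ _] := hn.
have := S_tail m n m4 hn; rewrite /S TE => St.
apply: le_trans (selected_statistic_tail _ _ Y_indep l_obs l_mean l_orth (m * m) n0 _) _.
  by rewrite divr_gt0.
apply: le_trans (leeD2r _ St) _.
rewrite -EFinD lee_fin invfM invrK mulrA mulfV ?gt_eqF// mul1r.
by rewrite [leRHS](splitr eps) lerD2r.
Unshelve. all: by end_near.
Qed.
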